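(* Let $\epsilon>0$ be a sufficiently small constant (i.e. there is an absolute constant $\epsilon_0>0$ such that the following holds for every constant $0<\epsilon\le\epsilon_0$), and let $p=p(d)\in[0,1]$ satisfy $p\ge \frac12-\epsilon$. Then with high probability there is a unique connected component in $Q^d_p$ on at least $(1-o(1))n$ vertices, where $n=2^d$. Furthermore, with high probability all the other components of $Q^d_p$ (if there are any) are isolated vertices, and every two distinct isolated vertices of $Q^d_p$ are at distance at least two in $Q^d$.
   Context: The $d$-dimensional binary hypercube $Q^d$ is the graph with vertex set $V=\{0,1\}^d$ in which two vertices are adjacent if and only if they differ in exactly one coordinate. It is $d$-regular on $n:=2^d$ vertices. For $p=p(d)\in[0,1]$, the random subgraph $Q^d_p\subseteq Q^d$ has vertex set $\{0,1\}^d$ and is obtained by retaining each edge of $Q^d$ independently with probability $p$. ''With high probability'' means with probability tending to one as $d\to\infty$. All asymptotics are as $d\to\infty$; $o(1)$ denotes a deterministic quantity tending to $0$ as $d\to\infty$. *)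

(* Defs.v *)
From mathcomp Require Import all_boot all_order all_algebra.
From mathcomp Require Import all_classical all_reals all_analysis.
Set Implicit Arguments.
Unset Strict Implicit.
Unset Printing Implicit Defensive.
Import Order.TTheory GRing.Theory Num.Theory.
Import numFieldNormedType.Exports.
Local Open Scope classical_set_scope.
Local Open Scope ring_scope.

(* A simple graph on T is given by its set of edges, an edge being an unordered
   pair [set x; y] of distinct vertices. *)
Section FiniteGraphs.
Variable T : finType.
Implicit Types (F : {set {set T}}) (x y : T) (C : {set T}).

Definition adj F : rel T := fun x y => [set x; y]%SET \in F.

Definition component F x : {set T} := [set y | connect (adj F) x y]%SET.

Definition components F : {set {set T}} := [set component F x | x : T]%SET.

Definition isolated F x : bool := [forall y, ~~ adj F x y].

(* Least length of a path from x to y in the graph e; a shortest path has fewer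
   than #|T| edges, and the value is #|T| when y is not reachable from x. *)
Definition gdist (e : rel T) x y : nat :=
  find (fun k => [exists s : k.-tuple T, path e x s && (last x s == y)])
       (iota 0 #|T|).

End FiniteGraphs.

Definition Qvertex (d : nat) : finType := {ffun 'I_d -> bool}.

Definition Qadj (d : nat) : rel (Qvertex d) :=
  fun x y => #|[set i | x i != y i]%SET| == 1%N.

Definition Qedges (d : nat) : {set {set Qvertex d}} :=
  [set e : {set Qvertex d} |
     [exists x, exists y, Qadj x y && (e == [set x; y]%SET)]]%SET.

(* Probability that the edge set F of the random subgraph of Q^d satisfies A:
   each edge of Q^d is independently in F with probability p. *)
Definition Pr_Qdp (R : realType) (d : nat) (p : R)
    (A : pred {set {set Qvertex d}}) : R :=
  \sum_(F in powerset (Qedges d) | A F)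
    \prod_(e in Qedges d) (if e \in F then p else 1 - p).

Definition whp (R : realType) (p : nat -> R)
    (A : forall d : nat, pred {set {set Qvertex d}}) : Prop :=
  (fun d => Pr_Qdp (p d) (A d)) @ \oo --> (1 : R).

Section Events.
Variables (R : realType) (d : nat) (delta : R).
Implicit Types (F : {set {set Qvertex d}}) (C : {set Qvertex d}).

(* delta is the value at d of the o(1) term. *)
Definition large C : bool := (1 - delta) * 2 ^+ d <= #|C|%:R.

Definition unique_large F C : bool :=
  [&& C \in components F, large C &
      [forall C' in components F, large C' ==> (C' == C)]].

Definition others_isolated F C : bool :=
  [forall C' in components F,
     (C' != C) ==> [exists v, isolated F v && (C' == [set v]%SET)]].

Definition isolated_far F : bool :=
  [forall u, forall v,
     [&& isolated F u, isolated F v & u != v] ==>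
       (2 <= gdist (@Qadj d) u v)%N].

End Events.

(* Main.v *)
Require Import Defs.
From mathcomp Require Import all_boot all_order all_algebra.
From mathcomp Require Import reals zify ring lra.

(** The graph is exposed in two independent rounds.  Every edge is kept in the
    first round with probability [a = 63/128] and in the second with the
    probability [b] given by [1 - p = (1 - a)(1 - b)]; the union of the two rounds
    is [Q^d_p], and [p >= 1/2 - 1/256] keeps [b] away from [0].

    First round.  The probability [q = 65/128] of losing an edge is only slightly
    above [1/2].  By Harper's edge-isoperimetric inequality
    ([edge_isoperimetry]), a set of [k] vertices loses all its boundary edges with
    probability at most [(k q^d)^k] ([prob_no_boundary]).  A connected set is
    grown from a vertex by adding neighbours one at a time, so that there are at
    most [2^d (K d)^k] connected sets of [k + 1 <= K] vertices ([card_grown]).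
    A union bound with [K = 2 L] and [L = 2^(d %/ 16)] shows that with high
    probability no connected set of [2] to [K] vertices is cut off from the rest
    of the cube.  In particular every component that is not a single vertex has
    more than [K] vertices, and no two isolated vertices are adjacent in the cube.
    The expected number of isolated vertices is [(2 q)^d = (65/64)^d], so that
    with high probability the edges of the cube at isolated vertices number at
    most [L] ([prob_rough]).

    Second round.  Let [T] be a set of at most half of the nontrivial components
    of the first round.  The isoperimetric inequality gives at least [2 L |T|]
    edges leaving them; at most [L] of these end at isolated vertices, so
    at least [L |T|] lead to other nontrivial components ([cut_nontrivial]).  The
    second round misses all of them with probability at most [x^|T|] where
    [x = (1 - b)^L], and the sum over the nonempty [T] is at most
    [(1 + x)^(2^d) - 1], which tends to [0] because [L] is exponential in [d]
    ([prob_unjoined]).  So the second round merges all nontrivial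
    components into one.  The vertices left outside are isolated in the first
    round, hence pairwise nonadjacent in the cube, hence isolated in the union
    ([second_round]); they are few, which makes the merged component large. *)

Set Implicit Arguments.
Unset Strict Implicit.
Unset Printing Implicit Defensive.

(** * Edge isoperimetry in the hypercube *)

Section Hypercube.
Variable d : nat.
Local Notation V := (Qvertex d).
Implicit Types (x y : V) (i j : 'I_d) (S A B : {set V}) (J : {set 'I_d}).

(** The vertices adjacent to [x] are the [flip i x], one for each direction [i]. *)
Definition flip i x : V := [ffun j => x j (+) (j == i)].

Lemma flipK i : involutive (flip i).
Proof. by move=> x; apply/ffunP => j; rewrite !ffunE addbK. Qed.

Lemma flip_inj i : injective (flip i).
Proof. exact: (can_inj (flipK i)). Qed.

Lemma flip_coord_inj x : injective (flip^~ x).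
Proof.
move=> i j /ffunP /(_ i); rewrite !ffunE eqxx.
by case: (x i); case: eqP.
Qed.

Lemma Qadj_flip x y : reflect (exists i, y = flip i x) (Qadj x y).
Proof.
apply: (iffP cards1P) => [[i /setP Hi]|[i ->]]; exists i.
  apply/ffunP => j; have := Hi j; rewrite !inE ffunE.
  by case: (x j); case: (y j); case: (j == i).
by apply/setP => j; rewrite !inE ffunE; case: (x j); case: (j == i).
Qed.

Lemma flip_neq i x : flip i x != x.
Proof. by apply/eqP => /ffunP /(_ i); rewrite ffunE eqxx; case: (x i). Qed.

Lemma QedgesP e :
  reflect (exists x i, e = [set x; flip i x]) (e \in Qedges d).
Proof.
rewrite inE; apply: (iffP existsP) => [[x /existsP[y /andP[/Qadj_flip[i ->] /eqP->]]]|].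
  by exists x, i.
move=> [x [i ->]]; exists x; apply/existsP; exists (flip i x).
by rewrite eqxx andbT; apply/Qadj_flip; exists i.
Qed.

Lemma adj_flip (F : {set {set V}}) x y :
  F \subset Qedges d -> adj F x y -> exists i, y = flip i x.
Proof.
move=> /subsetP FQ /FQ /QedgesP [z [i /setP E]].
have z_xy : (z == x) || (z == y) by have := E z; rewrite !inE eqxx.
have f_xy : (flip i z == x) || (flip i z == y) by have := E (flip i z); rewrite !inE eqxx orbT.
case/orP: z_xy f_xy => /eqP <-; rewrite (negbTE (flip_neq i z)) ?orbF /= => /eqP <-; exists i => //.
by rewrite flipK.
Qed.

Lemma card_Qvertex : #|V| = (2 ^ d)%N.
Proof. by rewrite card_ffun card_bool card_ord. Qed.

Definition cut A B : {set {set V}} :=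
  [set [set z.1; flip z.2 z.1] | z in [set z : V * 'I_d | (z.1 \in A) && (flip z.2 z.1 \in B)]].

Lemma cutP A B e : reflect (exists x i, [/\ x \in A, flip i x \in B & e = [set x; flip i x]])
  (e \in cut A B).
Proof.
apply: (iffP imsetP) => [[[x i]]|[x [i [xA xB ->]]]].
  by rewrite inE /= => /andP[? ?] ->; exists x, i.
by exists (x, i); rewrite // inE /= xA.
Qed.

Lemma cutC A B : cut A B = cut B A.
Proof.
have sub C D : cut C D \subset cut D C.
  apply/subsetP => e /cutP [x [i [xC xD ->]]]; apply/cutP; exists (flip i x), i.
  by rewrite flipK setUC.
by apply/eqP; rewrite eqEsubset !sub.
Qed.

Lemma cut_sub_Qedges A B : cut A B \subset Qedges d.
Proof. by apply/subsetP => e /cutP [x [i [_ _ ->]]]; apply/QedgesP; exists x, i. Qed.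

Definition crossing A B i := [set x in A | flip i x \in B].

(** Disjointness matters: an edge with both ends in [A] and both in [B] would
    be counted twice, once from each end. *)
Lemma card_cut A B : [disjoint A & B] -> #|cut A B| = \sum_i #|crossing A B i|.
Proof.
move=> dAB; rewrite card_in_imset; last first.
  move=> [x i] [y j]; rewrite !inE /= => /andP[xA xB] /andP[yA yB] /setP E.
  have xy : x = y.
    have := E x; rewrite !inE eqxx /= => /esym /orP[/eqP //|/eqP xf].
    by have := disjointFr dAB xA; rewrite xf yB.
  subst y; have := E (flip i x); rewrite !inE eqxx orbT => /esym /orP[/eqP xf|/eqP].
    by have := flip_neq i x; rewrite xf eqxx.
  by move=> /flip_coord_inj ->.
rewrite -sum1dep_card.
rewrite (eq_bigl (fun z : V * 'I_d => true && (z.1 \in crossing A B z.2))); last first.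
  by case=> x i; rewrite !inE.
have -> : \sum_i #|crossing A B i| = \sum_i \sum_(x in crossing A B i) 1.
  by apply: eq_bigr => i _; rewrite sum1_card.
rewrite (exchange_big_dep xpredT) //= pair_big_dep /=.
by apply: eq_bigl => -[x i] /=; rewrite !inE.
Qed.

Definition boundary S := cut S (~: S).

Lemma boundaryC S : boundary (~: S) = boundary S.
Proof. by rewrite /boundary setCK cutC. Qed.

(** Ordered pairs are counted, so this is twice the number of edges of [S] in the
    directions of [J].  Varying [J] makes it possible to induct on the number of
    directions inside a fixed cube. *)
Definition inner J S := \sum_(i in J) #|crossing S S i|.

Lemma card_boundary S : (#|boundary S| + inner setT S)%N = (d * #|S|)%N.
Proof.
rewrite /boundary card_cut ?disjoints_subset ?setCK // /inner.
rewrite [X in (_ + X)%N](eq_bigl xpredT) => [|i]; last by rewrite inE.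
rewrite -big_split /= (eq_bigr (fun=> #|S|)) ?sum_nat_const ?card_ord // => i _.
rewrite -(cardsID [set x | flip i x \in S] S) addnC.
congr addn; apply: eq_card => x; rewrite !inE //; by case: (x \in S); rewrite // andbC.
Qed.

Lemma crossing_split i j S (H := [set x : V | x i]) : j != i ->
  #|crossing S S j| = (#|crossing (S :&: H) (S :&: H) j|
     + #|crossing (S :\: H) (S :\: H) j|)%N.
Proof.
move=> ji; rewrite -(cardsID H (crossing S S j)).
by congr addn; apply: eq_card => x; rewrite !inE ffunE [i == j]eq_sym (negbTE ji) addbF;
  case: (x i); rewrite ?andbF ?andbT.
Qed.

(** An edge in direction [i] joins the two halves of the cube, and a vertex has
    at most one neighbour in the other half. *)
Lemma crossing_half i S (H := [set x : V | x i]) :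
  (#|crossing S S i| <= 2 * minn #|S :&: H| #|S :\: H|)%N.
Proof.
have card_le (C D : {set V}) : (#|crossing C D i| <= minn #|C| #|D|)%N.
  rewrite leq_min; apply/andP; split.
    by apply: subset_leq_card; apply/subsetP => x; rewrite inE => /andP[].
  rewrite -(card_imset _ (@flip_inj i)); apply: subset_leq_card.
  by apply/subsetP => _ /imsetP[x /[!inE] /andP[_ ?] ->].
rewrite mulSn mul1n.
apply: (@leq_trans (#|crossing (S :&: H) (S :\: H) i| + #|crossing (S :\: H) (S :&: H) i|)%N).
  rewrite -(cardsID H (crossing S S i)).
  apply: leq_add; apply: subset_leq_card; apply/subsetP => x; rewrite !inE ffunE eqxx;
  by case: (x i); rewrite ?andbF ?andbT.
by apply: leq_add; rewrite ?card_le // minnC card_le.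
Qed.

(** The entropy inequality behind the edge-isoperimetric inequality.  In product
    form it only needs [4ab <= (a + b)^2], raised to the power [min a b]. *)
Lemma expnn_superadd a b :
  (a ^ a * b ^ b * 2 ^ (2 * minn a b) <= (a + b) ^ (a + b))%N.
Proof.
wlog ba : a b / (b <= a)%N.
  move=> Hw; case/orP: (leq_total b a) => /Hw // le_ba.
  by rewrite minnC addnC [X in (X * _)%N]mulnC.
rewrite (minn_idPr ba).
have -> : (a ^ a * b ^ b * 2 ^ (2 * b) = a ^ (a - b) * (a * b * 4) ^ b)%N.
  by rewrite (expnM 2 2 b) !expnMn !mulnA -expnD subnK.
have -> : ((a + b) ^ (a + b) = (a + b) ^ (a - b) * ((a + b) ^ 2) ^ b)%N.
  by rewrite -expnM -expnD; congr expn; lia.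
apply: leq_mul; first by case: (a - b)%N => // n; rewrite leq_exp2r // leq_addr.
by case: b ba => // b ba; rewrite leq_exp2r // mulnC nat_AGM2.
Qed.

(** Harper's inequality: [k] vertices span at most [(k log2 k) / 2] edges.  Split
    [S] into two halves by a direction [i]; the edges inside the halves are
    bounded inductively, those between them by the smaller half. *)
Lemma edge_isoperimetry J S : (2 ^ inner J S <= #|S| ^ #|S|)%N.
Proof.
elim: {J}#|J| {-2}J (erefl #|J|) S => [|n IH] J cJ S.
  rewrite /inner (cards0_eq cJ) big_set0 expn0.
  by case: #|S| => // m; rewrite expn_gt0.
have /card_gt0P[i iJ] : (0 < #|J|)%N by rewrite cJ.
have cJ' : #|J :\ i| = n by apply: succn_inj; rewrite -cJ (cardsD1 i J) iJ.
pose H := [set x : V | x i].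
have -> : inner J S = (inner (J :\ i) (S :&: H) + inner (J :\ i) (S :\: H)
                     + #|crossing S S i|)%N.
  rewrite /inner (big_setD1 i) //= addnC -big_split /=; congr addn.
  by apply: eq_bigr => j /[!inE] /andP[ji _]; rewrite (crossing_split S ji).
rewrite -(cardsID H S); apply: leq_trans (expnn_superadd _ _).
rewrite [leqLHS]expnD [X in (X * _)%N]expnD; apply: leq_mul; first by apply: leq_mul; apply: IH.
by rewrite leq_exp2l // crossing_half.
Qed.

(** Harper's inequality gives [|S|] boundary edges when [S] fills at most half
    of the cube; otherwise the complement does, and has the same boundary. *)
Lemma card_boundary_ge S : (minn #|S| #|~: S| <= #|boundary S|)%N.
Proof.
wlog le_SC : S / (#|S| <= #|~: S|)%N => [Hw|].
  case/orP: (leq_total #|S| #|~: S|) => [/Hw //|le_CS].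
  by have := Hw (~: S); rewrite setCK boundaryC minnC; apply.
rewrite (minn_idPl le_SC).
have le_half : (2 * #|S| <= 2 ^ d)%N by rewrite -card_Qvertex -(cardsC S); lia.
have [->|[x xS]] := set_0Vmem S; first by rewrite cards0.
have S_gt0 : (0 < #|S|)%N by apply/card_gt0P; exists x.
have d_gt0 : (0 < d)%N.
  by rewrite -(@ltn_exp2l 2) // (leq_trans _ le_half) // (leq_mul2l 2 1) S_gt0.
have : (inner setT S <= d.-1 * #|S|)%N.
  rewrite -(@leq_exp2l 2) // (leq_trans (edge_isoperimetry _ _)) // expnM leq_exp2r //.
  by rewrite -(leq_pmul2l (ltn0Sn 1)) -expnS prednK.
have := card_boundary S; nia.
Qed.

(** * Vertex sets grown by adding neighbours *)

(** The sets reached from a vertex by adding [k] times a neighbour of what is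
    already there.  The new neighbour may be an old vertex, so the cardinal is
    at most, and not always, [k.+1]. *)
Fixpoint grown k : {set {set V}} :=
  if k is k'.+1 then
    \bigcup_(S in grown k') [set flip z.2 z.1 |: S | z in setX S [set: 'I_d]]
  else [set [set x] | x : V].

Lemma card_grown_mem k S : S \in grown k -> (#|S| <= k.+1)%N.
Proof.
elim: k S => [|k IH] S /=; first by case/imsetP => x _ ->; rewrite cards1.
case/bigcupP => S' /IH cS' /imsetP[z _ ->].
by rewrite cardsU1; case: (_ \notin _); lia.
Qed.

Lemma card_bigcup_le (I T : finType) (P : {set I}) (B : I -> {set T}) b :
  (forall u, u \in P -> #|B u| <= b)%N -> (#|\bigcup_(u in P) B u| <= #|P| * b)%N.
Proof.
move=> le_b; rewrite -sum_nat_const.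
elim/big_rec2 : _ => [|u m A /le_b le_i IH]; first by rewrite cards0.
by rewrite (leq_trans (leq_card_setU _ _)) ?leq_add.
Qed.

(** Each step chooses a vertex of the current set and a direction. *)
Lemma card_grown k K : (k < K)%N -> (#|grown k| <= 2 ^ d * (K * d) ^ k)%N.
Proof.
elim: k => [|k IH] kK /=.
  by rewrite expn0 muln1 -card_Qvertex; apply: leq_imset_card.
apply: leq_trans (_ : #|grown k| * (K * d) <= _)%N.
  apply: card_bigcup_le => S /card_grown_mem cS.
  rewrite (leq_trans (leq_imset_card _ _)) // cardsX cardsT card_ord.
  by rewrite leq_mul // (leq_trans cS) // ltnW.
by rewrite expnSr [leqRHS]mulnA leq_mul2r IH ?orbT // ltnW.
Qed.

(** * Components of a subgraph of the hypercube *)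

Lemma isolated_boundary (F : {set {set V}}) v :
  isolated F v -> [disjoint boundary [set v] & F].
Proof.
move=> /forallP iso; rewrite -setI_eq0; apply/eqP/setP => e; rewrite !inE.
apply/negP => /andP[/cutP[x [i [/set1P -> _ ->]]]].
by apply/negP; apply: iso.
Qed.

Section Components.
Variable F : {set {set V}}.
Hypothesis FQ : F \subset Qedges d.

Lemma adjC : symmetric (adj F).
Proof. by move=> x y; rewrite /adj setUC. Qed.

Lemma adj_connectC : connect_sym (adj F).
Proof. exact: sym_connect_sym adjC. Qed.

Lemma mem_component x : x \in component F x.
Proof. by rewrite inE connect0. Qed.

Lemma component_eq x y : y \in component F x -> component F y = component F x.
Proof.
rewrite inE => xy; apply/setP => z; rewrite !inE.
by rewrite (same_connect adj_connectC xy).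
Qed.

Lemma componentsP C x : C \in components F -> x \in C -> C = component F x.
Proof. by case/imsetP => y _ -> /component_eq. Qed.

Lemma connect_leaves S x y : connect (adj F) x y -> x \in S -> y \notin S ->
  exists z w, [/\ z \in S, w \notin S & adj F z w].
Proof.
move=> xy xS; case: (boolP [exists z, exists w, [&& z \in S, w \notin S & adj F z w]]).
  by case/existsP => z /existsP[w /and3P[zS wS zw]] _; exists z, w.
move=> /existsPn no_edge; rewrite -(@closed_connect _ (adj F) (mem S) _ _ _ xy) ?xS //.
apply: (intro_closed adj_connectC) => z w zw zS; apply/negPn/negP => wS.
by have /existsPn/(_ w) := no_edge z; rewrite zS wS zw.
Qed.

Lemma boundary_component C : C \in components F -> [disjoint boundary C & F].
Proof.
move=> CF; rewrite -setI_eq0; apply/eqP/setP => e; rewrite !inE.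
apply/negP => /andP[/cutP[x [i [xC]]] /[!inE] fC -> eF].
move: fC; rewrite (componentsP CF xC) inE.
by rewrite connect1.
Qed.

(** As long as the grown set is not all of [C], some edge of [F] leaves it. *)
Lemma grown_in_component C k : C \in components F -> (k < #|C|)%N ->
  exists S, [/\ S \in grown k, #|S| = k.+1 & S \subset C].
Proof.
move=> CF; elim: k => [|k IH] kC.
  have [x xC] := card_gt0P kC; exists [set x].
  by rewrite cards1 sub1set; split=> //; apply: imset_f.
have [S [Sg cS SC]] := IH (ltnW kC).
have [x xS] : exists x, x \in S by apply/card_gt0P; rewrite cS.
have [y yC yS] : exists2 y, y \in C & y \notin S.
  apply/subsetPn; apply: contraTN kC => /subset_leq_card; lia.
have CE := componentsP CF (subsetP SC _ xS).
have xy : connect (adj F) x y by move: yC; rewrite CE inE.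
have [z [w [zS wS zw]]] := connect_leaves xy xS yS.
have [i wE] := adj_flip FQ zw.
exists (w |: S); split.
- apply/bigcupP; exists S => //; apply/imsetP; exists (z, i); rewrite ?wE //.
  by rewrite !inE zS.
- by rewrite cardsU1 wS cS.
- rewrite subUset SC sub1set andbT CE inE (connect_trans _ (connect1 zw)) //.
  by have := subsetP SC _ zS; rewrite CE inE.
Qed.

Lemma component_grown C : C \in components F -> C \in grown #|C|.-1.
Proof.
move=> CF; have C_gt0 : (0 < #|C|)%N.
  by case/imsetP: CF => x _ ->; apply/card_gt0P; exists x; apply: mem_component.
have [|S [Sg cS SC]] := @grown_in_component C #|C|.-1 CF; first by rewrite prednK.
suff <- : S = C by rewrite cS.
by apply/eqP; rewrite eqEcard SC cS prednK /=.
Qed.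

Lemma isolated_component v : isolated F v -> component F v = [set v].
Proof.
move=> /forallP iso; apply/setP => y; rewrite !inE; apply/idP/eqP => [vy|->]; last exact: connect0.
apply/eqP; apply: contraT => ynv.
have [//||z [w [/set1P -> _ vw]]] := @connect_leaves [set v] v y vy; rewrite ?inE //.
by have := iso w; rewrite vw.
Qed.

End Components.

End Hypercube.

(** * Merging the components of a first round by a second one *)

Section Sprinkling.
Variable d : nat.
Local Notation V := (Qvertex d).
Implicit Types (x y : V) (i j : 'I_d) (S A B C D : {set V}) (F T : {set {set V}}).

Lemma card_cut_le A B : (#|cut A B| <= #|A| * d)%N.
Proof.
apply: leq_trans (leq_imset_card _ _) _.
rewrite -[X in (_ * X)%N]card_ord -cardsT -cardsX; apply: subset_leq_card.
by apply/subsetP => -[x i]; rewrite !inE /= andbT => /andP[].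
Qed.

Definition isolated_set F := [set v | isolated F v].

Definition nontrivial_components F := [set C in components F | 1 < #|C|].

Definition detached_grown F k :=
  [exists S in grown d k,
     (#|S| == k.+1) && [disjoint boundary S & F]].

(** The failures of the first round.  The first clause covers both components
    of size between [2] and [2 * L], which are grown sets, and pairs of adjacent
    isolated vertices, which need not be components; the second says that there
    are too many isolated vertices for their edges to be negligible. *)
Definition rough (L : nat) F :=
  [exists k : 'I_(2 * L), (0 < k) && detached_grown F k]
  || (L < d * #|isolated_set F|).

(** The failure of the second round.  Restricting to the smaller side [T] of the
    bipartition is what makes the union bound over [T] summable. *)
Definition unjoined F F' :=
  [exists T : {set {set V}}, [&& T \subset nontrivial_components F, T != set0,
     #|T| <= #|nontrivial_components F :\: T| &
     [disjoint cut (cover T) (cover (nontrivial_components F :\: T)) & F']]].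

Section FirstRound.
Variables (L : nat) (F : {set {set V}}).
Hypotheses (FQ : F \subset Qedges d) (F_smooth : ~~ rough L F).
Local Notation P := (nontrivial_components F).

Lemma smooth_grown k S : (0 < k < 2 * L)%N -> S \in grown d k -> #|S| = k.+1 ->
  ~~ [disjoint boundary S & F].
Proof.
move=> /andP[k0 kL] Sg cS; apply: contra F_smooth => dis; apply/orP; left.
apply/existsP; exists (Ordinal kL); rewrite k0; apply/existsP; exists S.
by rewrite Sg cS eqxx.
Qed.

Lemma smooth_isolated : (d * #|isolated_set F| <= L)%N.
Proof. by move: F_smooth; rewrite negb_or -leqNgt => /andP[]. Qed.

Lemma nontrivial_card C : C \in P -> (2 * L <= #|C|)%N.
Proof.
rewrite inE => /andP[CF C1]; rewrite leqNgt; apply/negP => CL.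
have := @smooth_grown #|C|.-1 C _ (component_grown FQ CF).
by rewrite boundary_component //; case/(_ _ _)/negP => //; lia.
Qed.

(** Two adjacent isolated vertices would form a grown set of size two without
    boundary edge. *)
Lemma smooth_adj_isolated i x : (0 < L)%N -> isolated F x -> ~~ isolated F (flip i x).
Proof.
move=> L0 ix; apply/negP => iy.
have : ~~ [disjoint boundary [set x; flip i x] & F].
  apply: (@smooth_grown 1); last by rewrite cards2 eq_sym flip_neq.
    lia.
  apply/bigcupP; exists [set x]; first exact: imset_f.
  by apply/imsetP; exists (x, i); rewrite ?inE ?eqxx // setUC.
case/negP; rewrite -setI_eq0; apply/eqP/setP => e; rewrite !inE.
apply/negP => /andP[/cutP[z [j [zS _ ->]]]]; apply/negP.
by case/set2P: zS => ->; [have /forallP := ix|have /forallP := iy]; apply.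
Qed.

Lemma nontrivial_trivIset T : T \subset P -> trivIset T.
Proof.
move=> /subsetP TP; apply/trivIsetP => C D /TP /[!inE] /andP[CF _] /TP /[!inE] /andP[DF _].
apply: contraR => /pred0Pn[x /= /andP[xC xD]].
by rewrite (componentsP CF xC) (componentsP DF xD).
Qed.

Lemma cover_nontrivial : cover P = ~: isolated_set F.
Proof.
apply/setP => x; rewrite !inE; apply/bigcupP/idP => [[C /[!inE] /andP[CF C1] xC]|nix].
  apply: contraL C1 => /isolated_component; rewrite (componentsP CF xC) => ->.
  by rewrite cards1.
exists (component F x); last exact: mem_component.
rewrite inE imset_f //=; move: nix; rewrite /isolated negb_forall => /existsP[y /negPn xy].
have [i yE] := adj_flip FQ xy.
rewrite (@leq_trans #|[set x; y]|) ?subset_leq_card //.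
  by rewrite cards2 yE eq_sym flip_neq.
by rewrite subUset !sub1set mem_component inE connect1.
Qed.

Lemma cover_nontrivial_sub T : T \subset P -> cover P = cover T :|: cover (P :\: T).
Proof.
by move=> TP; rewrite /cover -bigcup_setU setDE setUIr setUCr setIT (setUidPr TP).
Qed.

(** The isoperimetric inequality gives [2 * L * |T|] boundary edges, because each
    component in [T] has at least [2 * L] vertices and [T] is the smaller side.
    Those that do not lead to another nontrivial component are among the at most
    [L] edges of the cube at isolated vertices. *)
Lemma cut_nontrivial T : T \subset P -> T != set0 -> (#|T| <= #|P :\: T|)%N ->
  (L * #|T| <= #|cut (cover T) (cover (P :\: T))|)%N.
Proof.
move=> TP T0 leT.
have card_cover (U : {set {set V}}) : U \subset P -> (2 * L * #|U| <= #|cover U|)%N.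
  move=> UP; rewrite -(eqP (nontrivial_trivIset UP)) mulnC -sum_nat_const.
  by apply: leq_sum => C CU; apply: nontrivial_card; apply: (subsetP UP).
pose A := cover T; pose B := cover (P :\: T).
have cT := card_cover T TP.
have cU := card_cover (P :\: T) (subsetDl _ _).
have dAB : B \subset ~: A.
  rewrite -disjoints_subset -setI_eq0 /A /B.
  apply/eqP/setP => x; rewrite !inE; apply/negP => /andP[/bigcupP[C CU xC] /bigcupP[D DT xD]].
  have /trivIsetP tr := nontrivial_trivIset (subxx P).
  move: CU; rewrite inE => /andP[CT CP].
  have CD : C != D by apply: contraNneq CT => ->.
  have := tr C D CP (subsetP TP _ DT) CD; move/(disjointFr)/(_ xC); by rewrite xD.
have cutAI : (#|cut A (isolated_set F)| <= L)%N.
  by rewrite cutC (leq_trans (card_cut_le _ _)) // mulnC smooth_isolated.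
have sub : boundary A \subset cut A B :|: cut A (isolated_set F).
  apply/subsetP => e /cutP[x [i [xA yA ->]]]; rewrite inE.
  have : flip i x \in isolated_set F :|: cover P by rewrite cover_nontrivial setUCr inE.
  rewrite (cover_nontrivial_sub TP) !in_setU.
  rewrite in_setC in yA; rewrite -/A (negbTE yA) /=.
  case/orP => H; apply/orP; [right|left]; apply/cutP; by exists x, i.
have := subset_leq_card sub.
have := card_boundary_ge A.
have := (leq_card_setU (cut A B) (cut A (isolated_set F))).1.
have := subset_leq_card dAB.
have : (0 < #|T|)%N by rewrite card_gt0.
rewrite -/A -/B in cT cU *.
move: cT cU cutAI leT.
set a := #|A|; set b := #|B|; set c := #|~: A|; set t := #|T|; set u := #|P :\: T|.
set ca := #|boundary A|.
move=> cT cU cutAI leT t0 bc H1 H2 H3.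
have h1 : (2 * L * t <= minn a c)%N.
  by rewrite leq_min cT (leq_trans _ bc) // (leq_trans _ cU) // leq_mul2l leT orbT.
have h2 : (L <= L * t)%N by rewrite leq_pmulr.
rewrite -mulnA in h1; lia.
Qed.

End FirstRound.

(** The cube has two vertices, so the search for a shortest path does reach the
    lengths [0] and [1]. *)
Lemma gdist_ge2 x y : x != y -> ~~ Qadj x y -> (2 <= gdist (@Qadj d) x y)%N.
Proof.
move=> xy nadj; rewrite /gdist; set p := fun _ => _.
have V2 : (1 < #|V|)%N.
  rewrite (@leq_trans #|[set x; y]|) ?max_card //.
  by rewrite cards2 xy.
rewrite leqNgt; apply/negP => lt2.
have hp : has p (iota 0 #|V|) by rewrite has_find size_iota (leq_trans lt2).
have := nth_find 0 hp; rewrite nth_iota; last by rewrite (leq_trans lt2).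
rewrite add0n.
case: (find p _) lt2 => [|[|//]] _ /existsP[s].
  by rewrite (tuple0 s) /= (negbTE xy).
case: s => -[|z [|//]] //= _; rewrite andbT => /andP[xz /eqP zy].
by rewrite -zy xz in nadj.
Qed.

(** The component of [F :|: F'] of one non-isolated vertex contains all of them:
    otherwise the nontrivial components of [F] split into those inside and those
    outside, with no edge of [F'] in between.  What remains outside is isolated
    in [F], and no two isolated vertices of [F] are adjacent in the cube. *)
Lemma second_round L F F' : (0 < L)%N -> (2 * L + 1 < 2 ^ d)%N ->
  F :|: F' \subset Qedges d -> ~~ rough L F -> ~~ unjoined F F' ->
  exists C, [/\ C \in components (F :|: F'), (2 ^ d <= #|C| + 2 * L)%N,
    others_isolated (F :|: F') C & isolated_far (F :|: F')].
Proof.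
move=> L0 Ld GQ smooth joined; set G := F :|: F'.
have FQ : F \subset Qedges d by apply: subset_trans GQ; apply: subsetUl.
have d0 : (0 < d)%N.
  by rewrite -(@ltn_exp2l 2) //; lia.
pose P := nontrivial_components F.
have leI : (#|isolated_set F| <= L)%N.
  by rewrite (leq_trans _ (smooth_isolated smooth)) // leq_pmull.
have FG x y : adj F x y -> adj G x y by rewrite /adj inE => ->.
have compFG x : component F x \subset component G x.
  apply/subsetP => y; rewrite !inE; apply: connect_sub => {}x {}y /FG; exact: connect1.
have [x xP] : exists x, x \in cover P.
  apply/card_gt0P; rewrite (cover_nontrivial FQ).
  by have := cardsC (isolated_set F); rewrite card_Qvertex; lia.
pose C := component G x.
have CG : C \in components G by apply: imset_f.
have PC : cover P \subset C.
  pose T := [set D in P | D \subset C].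
  have TP : T \subset P by apply/subsetP => D; rewrite inE => /andP[].
  have T0 : T != set0.
    case/bigcupP: xP => D DP xD; apply/set0Pn; exists D; rewrite inE DP.
    by move: DP; rewrite inE => /andP[DF _]; rewrite (componentsP DF xD) compFG.
  have closed_T : [disjoint cut (cover T) (cover (P :\: T)) & F'].
    rewrite -setI_eq0; apply/eqP/setP => e; rewrite !inE; apply/negP => /andP[].
    case/cutP => y [i [/bigcupP[D DT yD] /bigcupP[D' D'T wD'] ->]] eF'.
    move: D'T; rewrite !inE -andbA => /and3P[D'T D'F D'1]; rewrite D'F D'1 /= in D'T.
    case/negP: D'T; rewrite (componentsP D'F wD').
    have yC : y \in C by move: DT; rewrite inE => /andP[_ /subsetP]; apply.
    have wC : flip i y \in C.
      by have <- : component G y = C := component_eq yC; rewrite inE connect1 // /adj inE eF' orbT.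
    by have <- : component G (flip i y) = C := component_eq wC; apply: compFG.
  have [PT|/set0Pn PT] := eqVneq (P :\: T) set0.
    apply/bigcupsP => D DP; have : D \in T.
      by apply: (subsetP _ _ DP); rewrite -setD_eq0 PT.
    by rewrite inE => /andP[].
  case/negP: joined; apply/existsP.
  case/orP: (leq_total #|T| #|P :\: T|) => le.
    by exists T; rewrite TP T0 le.
  exists (P :\: T); have -> : P :\: (P :\: T) = T by rewrite setDDr setDv set0U (setIidPr TP).
  by rewrite subsetDl le cutC closed_T /= andbT; apply/set0Pn.
have sparse i y : isolated F y -> ~~ isolated F (flip i y).
  by apply: smooth_adj_isolated L0.
have isoGF y : isolated G y -> isolated F y.
  by move=> /forallP iso; apply/forallP => z; apply: contra (iso z) => /FG.
have notC y : y \notin C -> isolated F y.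
  move=> yC; have := contra (subsetP PC y) yC.
  by rewrite (cover_nontrivial FQ) !inE negbK.
exists C; split=> //.
- have := subset_leq_card PC; rewrite (cover_nontrivial FQ).
  by have := cardsC (isolated_set F); rewrite card_Qvertex; lia.
- apply/forallP => C'; apply/implyP => C'G; apply/implyP => C'C.
  case/imsetP: C'G C'C => v _ -> vC.
  have compC y : y \in component G v -> y \notin C.
    by move=> yv; apply: contra vC => yC; rewrite -(component_eq yv); apply/eqP/component_eq.
  have iv : isolated G v.
    apply/forallP => y; apply/negP => vy.
    have [i yE] := adj_flip GQ vy.
    have := sparse i v (notC v (compC v (mem_component _ _))).
    by rewrite -yE notC // compC // inE connect1.
  apply/existsP; exists v; rewrite iv isolated_component //=.
- apply/forallP => u; apply/forallP => v; apply/implyP => /and3P[iu iv uv].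
  apply: gdist_ge2 => //; apply/negP => /Qadj_flip[i vE].
  by have := sparse i u (isoGF _ iu); rewrite -vE isoGF.
Qed.

End Sprinkling.

Import Order.TTheory GRing.Theory Num.Theory.
Local Open Scope ring_scope.

(** * Random subsets of a finite type *)

Section RandomSubsets.
Variables (R : realFieldType) (E : finType).
Implicit Types (p q : E -> R) (F S : {set E}) (A B : pred {set E}).

Definition weight p F : R := \prod_e (if e \in F then p e else 1 - p e).

Definition prob p A : R := \sum_(F | A F) weight p F.

(** Turns an event that is a conjunction over the points [e] into a factor of
    the weight, so that the sum over subsets factorizes. *)
Lemma prod_if_all (b : pred E) (f : E -> R) :
  \prod_e (if b e then f e else 0) = if [forall e, b e] then \prod_e f e else 0.
Proof.
case: forallP => [b_all|/forallP]; first by apply: eq_bigr => e _; rewrite b_all.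
by rewrite negb_forall => /existsP[e /negbTE be]; rewrite (bigD1 e) //= be mul0r.
Qed.

Lemma probT p : prob p xpredT = 1.
Proof.
rewrite /prob /weight -bigA_distr big1 // => e _; exact: subrKC.
Qed.

Lemma prob_disjoint p S : prob p (fun F => [disjoint S & F]) = \prod_(e in S) (1 - p e).
Proof.
rewrite /prob big_mkcond /=.
under eq_bigr => F _.
  have -> : [disjoint S & F] = [forall e, (e \in S) ==> (e \notin F)].
    apply/idP/forallP => [dis e|dis].
      by apply/implyP => eS; rewrite (disjointFr dis).
    by rewrite disjoints_subset; apply/subsetP => e; rewrite inE; apply/implyP.
  rewrite -prod_if_all.
  under eq_bigr => e _.
    have -> : (if (e \in S) ==> (e \notin F) then if e \in F then p e else 1 - p e else 0)
      = if e \in F then (if e \in S then 0 else p e) else 1 - p e.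
      by case: (e \in S); case: (e \in F).
    over.
  over.
rewrite -bigA_distr [RHS]big_mkcond /=; apply: eq_bigr => e _.
by case: ifP => _; [rewrite add0r | rewrite subrKC].
Qed.

(** A point misses the union of two independent random subsets when it misses
    both, which happens with probability [(1 - p e) * (1 - q e)]. *)
Lemma weight_union p q r F : (forall e, 1 - r e = (1 - p e) * (1 - q e)) ->
  \sum_F1 weight p F1 * (\sum_(F2 | F1 :|: F2 == F) weight q F2) = weight r F.
Proof.
move=> rE.
under eq_bigr => F1 _.
  rewrite big_mkcond /=.
  under eq_bigr => F2 _.
    have -> : (F1 :|: F2 == F) = [forall e, ((e \in F1) || (e \in F2)) == (e \in F)].
      by apply/eqP/forallP => [<- e|H]; [rewrite inE | apply/setP => e; rewrite inE; apply/eqP].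
    rewrite -prod_if_all.
    under eq_bigr => e _.
      have -> : (if (e \in F1) || (e \in F2) == (e \in F)
          then if e \in F2 then q e else 1 - q e else 0)
        = if e \in F2 then (if e \in F then q e else 0)
          else (if (e \in F1) == (e \in F) then 1 - q e else 0).
        by case: (e \in F1); case: (e \in F2); case: (e \in F).
      over.
    over.
  rewrite -bigA_distr /weight -big_split /=.
  under eq_bigr => e _.
    have -> : (if e \in F1 then p e else 1 - p e) *
        ((if e \in F then q e else 0) + (if (e \in F1) == (e \in F) then 1 - q e else 0))
      = if e \in F1 then (if e \in F then p e else 0)
        else (if e \in F then (1 - p e) * q e else (1 - p e) * (1 - q e)).
      by case: (e \in F1); case: (e \in F) => /=; ring.
    over.
  over.
rewrite -bigA_distr; apply: eq_bigr => e _.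
case: (e \in F) => /=; first by rewrite -[r e](subKr 1) rE; ring.
by rewrite add0r rE.
Qed.

Lemma prob_union p q r A : (forall e, 1 - r e = (1 - p e) * (1 - q e)) ->
  prob r A = \sum_F weight p F * prob q (fun F' => A (F :|: F')).
Proof.
move=> rE; rewrite /prob.
under eq_bigr => F _ do rewrite -(weight_union F rE).
rewrite exchange_big /=; apply: eq_bigr => F1 _.
rewrite -mulr_sumr; congr (_ * _).
rewrite [RHS](partition_big (fun F2 => F1 :|: F2) A) //=.
apply: eq_bigr => F AF; apply: eq_bigl => F2.
by case: eqP => [->|]; rewrite ?AF ?andbF.
Qed.

Definition is_prob p := forall e, 0 <= p e <= 1.

Section Bounds.
Variable p : E -> R.
Hypothesis p01 : is_prob p.

Lemma weight_ge0 F : 0 <= weight p F.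
Proof.
by apply: prodr_ge0 => e _; have /andP[? ?] := p01 e; case: ifP; rewrite ?subr_ge0.
Qed.

Lemma prob_sub A B : (forall F, A F -> B F) -> prob p A <= prob p B.
Proof.
move=> AB; rewrite /prob big_mkcond [leRHS]big_mkcond /=; apply: ler_sum => F _.
by case: ifP => [/AB ->//|_]; case: ifP => // _; apply: weight_ge0.
Qed.

Lemma prob_le1 A : prob p A <= 1.
Proof. by rewrite -(probT p) prob_sub. Qed.

Lemma union_bound (I : finType) (P : pred I) (B : I -> pred {set E}) A :
  (forall F, A F -> exists2 i, P i & B i F) ->
  prob p A <= \sum_(i | P i) prob p (B i).
Proof.
move=> AB; rewrite /prob; under [leRHS]eq_bigr => i _ do rewrite big_mkcond.
rewrite exchange_big /= [leLHS]big_mkcond /=; apply: ler_sum => F _.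
have ge0 (P' : pred I) : 0 <= \sum_(i | P' i) (if B i F then weight p F else 0).
  by apply: sumr_ge0 => i _; case: ifP => // _; apply: weight_ge0.
case: ifP => [/AB[i Pi BiF]|//].
by rewrite (bigD1 i) //= BiF lerDl.
Qed.

Lemma markov_card (I : finType) (B : I -> pred {set E}) (c : R) :
  c * prob p (fun F => c <= #|[set i | B i F]|%:R) <= \sum_i prob p (B i).
Proof.
rewrite /prob; under [leRHS]eq_bigr => i _ do rewrite big_mkcond.
rewrite exchange_big /= mulr_sumr [leLHS]big_mkcond /=; apply: ler_sum => F _.
have -> : \sum_i (if B i F then weight p F else 0) = #|[set i | B i F]|%:R * weight p F.
  by rewrite -big_mkcond /= sumr_const mulr_natl cardsE.
by case: ifP => [le|_]; [rewrite ler_wpM2r ?weight_ge0 | rewrite mulr_ge0 ?ler0n ?weight_ge0].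
Qed.

End Bounds.

(** Two-round exposure: [B] is the failure of the first round, and [b] bounds the
    conditional probability of [A] once the first round has succeeded. *)
Lemma prob_sprinkle p q r A B (b : R) : is_prob p -> is_prob q ->
  (forall e, 1 - r e = (1 - p e) * (1 - q e)) -> 0 <= b ->
  (forall F, ~~ B F -> prob q (fun F' => A (F :|: F')) <= b) ->
  prob r A <= prob p B + b.
Proof.
move=> p01 q01 rE b0 Bb; rewrite (prob_union A rE).
apply: (@le_trans _ _ (\sum_F weight p F * ((B F)%:R + b))).
  apply: ler_sum => F _; rewrite ler_wpM2l ?weight_ge0 //.
  case: (boolP (B F)) => BF; last by rewrite add0r Bb.
  by rewrite (le_trans (prob_le1 q01 _)) // lerDl.
under eq_bigr => F _ do rewrite mulrDr.
rewrite big_split /= -mulr_suml.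
have -> : \sum_F weight p F = 1 by rewrite -(probT p).
rewrite mul1r lerD2r /prob big_mkcond /= [leRHS]big_mkcond /=.
by apply: ler_sum => F _; case: (B F); rewrite ?mulr1 ?mulr0.
Qed.

Lemma sum_powerset (P : {set E}) (x : R) :
  \sum_(T in powerset P) x ^+ #|T| = (1 + x) ^+ #|P|.
Proof.
rewrite -prodr_const big_mkcond /=.
transitivity (\prod_e ((if e \in P then x else 0) + 1)); last first.
  by rewrite [RHS]big_mkcond /=; apply: eq_bigr => e _; case: ifP; rewrite ?add0r // addrC.
rewrite bigA_distr; apply: eq_bigr => T _; rewrite powersetE.
case: ifP => [/subsetP TP|/negbT/subsetPn[e eT /negbTE eP]].
  rewrite -prodr_const big_mkcond /=; apply: eq_bigr => e _.
  by case: ifP => // /TP ->.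
by rewrite (bigD1 e) //= eT eP mul0r.
Qed.

End RandomSubsets.

(** Non-edges get probability [0], which turns the random subgraph into a random
    subset of the whole type of vertex sets. *)
Definition edge_prob (R : realType) d (p : R) : {set Qvertex d} -> R :=
  fun e => if e \in Qedges d then p else 0.

Lemma Pr_QdpE (R : realType) d (p : R) A :
  Pr_Qdp p A = prob (@edge_prob R d p) (fun F => (F \subset Qedges d) && A F).
Proof.
rewrite /Pr_Qdp /prob; apply: eq_big => F; first by rewrite powersetE.
rewrite powersetE => /andP[FQ _]; rewrite /weight big_mkcond /=.
apply: eq_bigr => e _; rewrite /edge_prob; case: ifP => // eQ.
by case: ifP => [/(subsetP FQ)|_]; rewrite ?eQ // subr0.
Qed.

Lemma Pr_Qdp_compl (R : realType) d (p : R) (A : pred {set {set Qvertex d}}) :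
  Pr_Qdp p A = 1 - prob (@edge_prob R d p) (fun F => (F \subset Qedges d) && ~~ A F).
Proof.
rewrite -(Pr_QdpE p (fun F => ~~ A F)).
have <- : @Pr_Qdp R d p xpredT = 1.
  rewrite -[RHS](probT (@edge_prob R d p)) Pr_QdpE [RHS]/prob.
  rewrite [RHS](bigID (fun F : {set {set Qvertex d}} => F \subset Qedges d)) /=.
  rewrite [X in _ + X]big1 ?addr0; first by apply: eq_bigl => F; rewrite andbT.
  move=> F /subsetPn[e eF /negbTE eQ]; rewrite /weight (bigD1 e) //= eF /edge_prob eQ mul0r //.
apply/eqP; rewrite eq_sym subr_eq /Pr_Qdp [eqbLHS](bigID A) /=; apply/eqP.
by congr (_ + _); apply: eq_bigl => F; rewrite andbT.
Qed.

(** * Failure probabilities of the two rounds *)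

(** Bernoulli's inequality read upwards.  It is used with [x > 0] to bound powers
    from above and with [x < 0] to show that they decay or grow fast enough. *)
Lemma expr_1D_le (R : realFieldType) (x : R) n : -1 <= x ->
  (1 + x) ^+ n * (1 - n%:R * x) <= 1.
Proof.
move=> x_ge; have x0 : 0 <= 1 + x by lra.
elim: n => [|n IH]; first by rewrite expr0 mul0r subr0 mul1r.
apply: le_trans IH; rewrite exprSr -mulrA ler_wpM2l ?exprn_ge0 //.
have xx : 0 <= n.+1%:R * (x * x) by rewrite mulr_ge0 // -expr2 sqr_ge0.
by rewrite -natr1 in xx *; lra.
Qed.

Lemma expr_1DB1_le (R : realFieldType) (x : R) n : 0 <= x -> n%:R * x <= 1 / 2 ->
  (1 + x) ^+ n - 1 <= 2 * (n%:R * x).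
Proof.
move=> x0; have inv : (1 + x) ^+ n * (1 - n%:R * x) <= 1 by rewrite expr_1D_le //; lra.
have t0 : 0 <= (1 + x) ^+ n by rewrite exprn_ge0 ?addr_ge0.
have s0 : 0 <= n%:R * x by rewrite mulr_ge0.
move: inv t0 s0; set t := (1 + x) ^+ n; set s := n%:R * x => inv t0 s0 s2.
have t_half : 0 <= t * (1 / 2 - s) by rewrite mulr_ge0 // subr_ge0.
have t2 : 0 <= (2 - t) * s by rewrite mulr_ge0 //; lra.
lra.
Qed.

Section RoundBounds.
Variables (R : realType) (d : nat).
Local Notation V := (Qvertex d).
Implicit Types (p : R) (S : {set V}) (F : {set {set V}}).
Local Notation ep p := (@edge_prob R d p).

Lemma edge_prob01 p : 0 <= p <= 1 -> is_prob (ep p).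
Proof. by move=> p01 e; rewrite /edge_prob; case: ifP => // _; rewrite lexx ler01. Qed.

Lemma prob_no_cut p (A B : {set V}) :
  prob (ep p) (fun F => [disjoint cut A B & F]) = (1 - p) ^+ #|cut A B|.
Proof.
rewrite prob_disjoint -prodr_const; apply: eq_bigr => e /(subsetP (cut_sub_Qedges A B)) eQ.
by rewrite /edge_prob eQ.
Qed.

(** With [q = 1 - p] and [D] the number of ordered inner pairs, the probability is
    [q ^ (d k - D)], and [q ^ D >= 2 ^ (- D) >= k ^ (- k)] by Harper's inequality;
    this is where [p <= 1/2] enters. *)
Lemma prob_no_boundary p S : 0 <= p <= 1 / 2 ->
  prob (ep p) (fun F => [disjoint boundary S & F]) <= (#|S|%:R * (1 - p) ^+ d) ^+ #|S|.
Proof.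
move=> /andP[p0 p2]; rewrite prob_no_cut -/(boundary S).
set q := 1 - p; have q2 : 1 / 2 <= q by rewrite /q; lra.
have q0 : 0 <= q by lra.
have q1 : 1 <= 2 * q by lra.
have iso : (2 ^+ inner setT S : R) <= (#|S|%:R) ^+ #|S|.
  by rewrite -!natrX ler_nat edge_isoperimetry.
rewrite exprMn -exprM -card_boundary exprD mulrCA.
rewrite ler_peMr ?exprn_ge0 // (@le_trans _ _ ((2 * q) ^+ inner setT S)) //.
  by rewrite exprn_ege1.
by rewrite exprMn ler_wpM2r ?exprn_ge0.
Qed.

(** The first term sums over the grown sets of size [k.+1]: there are at most
    [2^d (K d)^k] of them and each lacks boundary edges with probability at most
    [(K q^d)^(k+1)], so that every [k >= 1] contributes at most [2^d y^2].  The
    second is Markov's inequality for the number of isolated vertices. *)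
Lemma prob_rough p L (K := (2 * L)%:R : R) (y := K ^+ 2 * d%:R * (1 - p) ^+ d) :
  (0 < L)%N -> (0 < d)%N -> 0 <= p <= 1 / 2 -> y <= 1 ->
  prob (ep p) (rough L) <= K * 2 ^+ d * y ^+ 2 + d%:R * (2 * (1 - p)) ^+ d / L%:R.
Proof.
move=> L0 d0 p02 y1; have /andP[p0 p2] := p02.
have p01 : 0 <= p <= 1 by lra.
have P01 := edge_prob01 p01.
have q0 : 0 <= 1 - p by lra.
have K1 : 1 <= K by rewrite /K ler1n muln_gt0.
have K0 : 0 <= K by lra.
have d1 : 1 <= d%:R :> R by rewrite ler1n.
have y0 : 0 <= y by rewrite !mulr_ge0 ?exprn_ge0 //; lra.
have qd0 : 0 <= (1 - p) ^+ d by rewrite exprn_ge0.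
pose Bad (b : bool) F := if b then [exists k : 'I_(2 * L), (0 < k)%N && detached_grown F k]
  else (L < d * #|isolated_set F|)%N.
apply: (@le_trans _ _ (\sum_b prob (ep p) (Bad b))).
  by apply: union_bound => // F /orP[H|H]; [exists true|exists false].
rewrite big_bool /=; apply: lerD.
  apply: (@le_trans _ _ (\sum_(k < 2 * L | (0 < k)%N) prob (ep p) (fun F => detached_grown F k))).
    apply: union_bound => // F /existsP[k /andP[k0 H]]; by exists k.
  apply: (@le_trans _ _ (\sum_(k < 2 * L) 2 ^+ d * y ^+ 2)); last first.
    by rewrite sumr_const card_ord -[leLHS]mulr_natl mulrA.
  rewrite big_mkcond /=; apply: ler_sum => k _; case: ifP => k0; last first.
    by rewrite mulr_ge0 ?exprn_ge0.
  apply: (@le_trans _ _ (\sum_(S | (S \in grown d k) && (#|S| == k.+1))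
            prob (ep p) (fun F => [disjoint boundary S & F]))).
    apply: union_bound => // F /existsP[S /and3P[Sg cS dis]]; exists S => //.
    by rewrite Sg.
  apply: (@le_trans _ _ (\sum_(S in grown d k) (K * (1 - p) ^+ d) ^+ k.+1)).
    rewrite big_mkcondr /=; apply: ler_sum => S _.
    case: eqP => [cS|_]; last by rewrite exprn_ge0 // mulr_ge0 //; lra.
    apply: le_trans (prob_no_boundary S p02) _; rewrite cS lerXn2r //.
    - by rewrite nnegrE mulr_ge0.
    - by rewrite nnegrE mulr_ge0 //; lra.
    - by rewrite ler_wpM2r // ler_nat.
  rewrite sumr_const -[leLHS]mulr_natl.
  apply: (@le_trans _ _ (2 ^+ d * (K * d%:R) ^+ k.+1 * (K * (1 - p) ^+ d) ^+ k.+1)).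
    rewrite ler_wpM2r ?exprn_ge0 ?mulr_ge0 //.
    apply: (@le_trans _ _ ((2 ^ d * (2 * L * d) ^ k)%:R)); first by rewrite ler_nat card_grown.
    rewrite natrM !natrX natrM ler_wpM2l ?exprn_ge0 // ler_weXn2l //.
    by rewrite -natrM ler1n muln_gt0 muln_gt0 L0.
  rewrite -mulrA -exprMn ler_wpM2l ?exprn_ge0 //.
  have -> : K * d%:R * (K * (1 - p) ^+ d) = y by rewrite /y; ring.
  by rewrite ler_wiXn2l.
pose c : R := L%:R / d%:R.
have c0 : 0 < c by rewrite divr_gt0 ?ltr0n.
have ci : 0 <= c^-1 by rewrite invr_ge0 ltW.
have -> : d%:R * (2 * (1 - p)) ^+ d / L%:R = c^-1 * (2 ^+ d * (1 - p) ^+ d).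
  by rewrite exprMn /c invf_div; ring.
rewrite -[leLHS](mulKf (lt0r_neq0 c0)) (ler_wpM2l ci) //.
apply: (@le_trans _ _ (c * prob (ep p) (fun F => c <= #|[set v | isolated F v]|%:R))).
  rewrite (ler_wpM2l (ltW c0)) // prob_sub // => F /= lt.
  by rewrite /c ler_pdivrMr ?ltr0n // mulrC -natrM ler_nat ltnW.
apply: le_trans (markov_card P01 _ _) _.
have -> : 2 ^+ d * (1 - p) ^+ d = \sum_(v : V) (1 - p) ^+ d :> R.
  by rewrite sumr_const cardT -cardE card_Qvertex -[RHS]mulr_natl natrX.
apply: ler_sum => v _.
apply: (@le_trans _ _ (prob (ep p) (fun F => [disjoint boundary [set v] & F]))).
  by apply: prob_sub => // F; apply: isolated_boundary.
by apply: le_trans (prob_no_boundary _ p02) _; rewrite cards1 expr1 mul1r.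
Qed.

(** With [x = (1 - p)^L], a given [T] fails with probability at most [x^|T|], and
    summing over the nonempty [T] gives [(1 + x)^|P| - 1] where [|P| <= 2^d]. *)
Lemma prob_unjoined p L F : (0 < L)%N -> 0 <= p <= 1 -> F \subset Qedges d -> ~~ rough L F ->
  2 ^+ d * (1 - p) ^+ L <= 1 / 2 ->
  prob (ep p) (unjoined F) <= 2 * (2 ^+ d * (1 - p) ^+ L).
Proof.
move=> L0 p01 FQ smooth small; have /andP[p0 p1] := p01.
have P01 := edge_prob01 p01.
have q0 : 0 <= 1 - p by lra.
set x := (1 - p) ^+ L; have x0 : 0 <= x by rewrite exprn_ge0.
set P := nontrivial_components F.
have cP : (#|P| <= 2 ^ d)%N.
  rewrite -card_Qvertex (leq_trans (subset_leq_card (_ : P \subset components F))) //.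
    by apply/subsetP => C; rewrite inE => /andP[].
  exact: leq_imset_card.
pose side (T : {set {set V}}) := [&& T \subset P, T != set0 & (#|T| <= #|P :\: T|)%N].
apply: (@le_trans _ _ (\sum_(T | side T)
   prob (ep p) (fun F' => [disjoint cut (cover T) (cover (P :\: T)) & F']))).
  apply: union_bound => // F' /existsP[T /and4P[TP T0 le dis]]; exists T => //.
  by rewrite /side TP T0.
apply: (@le_trans _ _ (\sum_(T in powerset P | T != set0) x ^+ #|T|)).
  rewrite big_mkcond [leRHS]big_mkcond /=; apply: ler_sum => T _.
  rewrite /side powersetE; case: (boolP (T \subset P)) => //= TP.
  case: (boolP (T == set0)) => //= T0.
  case: ifP => [le|_]; last by rewrite exprn_ge0.
  rewrite prob_no_cut /x -exprM ler_wiXn2l //; first lra.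
  exact: cut_nontrivial.
have -> : \sum_(T in powerset P | T != set0) x ^+ #|T| = (1 + x) ^+ #|P| - 1.
  rewrite -sum_powerset [X in _ = X - 1](bigD1 set0) ?powersetE ?sub0set //=.
  by rewrite cards0 expr0 addrAC subrr add0r.
have nx : (#|P|%:R : R) * x <= 2 ^+ d * x.
  by rewrite ler_wpM2r // -natrX ler_nat.
apply: le_trans (expr_1DB1_le x0 (le_trans nx small)) _.
by rewrite ler_wpM2l.
Qed.

Definition structured (delta : R) F := [exists C,
  [&& unique_large delta F C, others_isolated F C & isolated_far F]].

(** Any other component is a single vertex, hence too small to be large. *)
Lemma second_round_structured L F F' : (0 < L)%N -> (2 * L + 1 < 2 ^ d)%N ->
  F :|: F' \subset Qedges d -> ~~ rough L F -> ~~ unjoined F F' ->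
  structured ((2 * L)%:R / 2 ^+ d) (F :|: F').
Proof.
move=> L0 Ld GQ smooth joined.
have [C [CG cC others far]] := second_round L0 Ld GQ smooth joined.
apply/existsP; exists C; rewrite others far !andbT /unique_large CG /=.
have largeE (D : {set V}) : large ((2 * L)%:R / 2 ^+ d) D = (2 ^ d <= #|D| + 2 * L)%N.
  rewrite /large mulrBl mul1r divfK ?expf_neq0 ?pnatr_eq0 //.
  by rewrite lerBlDr -natrX -natrD ler_nat.
rewrite largeE cC /=; apply/forallP => C'; apply/implyP => C'G; apply/implyP.
rewrite largeE; apply: contraTT => C'C.
have /forallP/(_ C') := others; rewrite C'G C'C /= => /existsP[v /andP[_ /eqP ->]].
by rewrite cards1 -ltnNge addnC.
Qed.

(** The second round uses [b] with [1 - p = (1 - a) (1 - b)], so that the union of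
    the two rounds has edge probability [p]. *)
Lemma Pr_structured a p L (K := (2 * L)%:R : R) (y := K ^+ 2 * d%:R * (1 - a) ^+ d)
    (z := 2 ^+ d * ((1 - p) / (1 - a)) ^+ L) :
  (0 < L)%N -> (2 * L + 1 < 2 ^ d)%N -> 0 <= a <= 1 / 2 -> a <= p <= 1 ->
  y <= 1 -> z <= 1 / 2 ->
  1 - (K * 2 ^+ d * y ^+ 2 + d%:R * (2 * (1 - a)) ^+ d / L%:R + 2 * z)
    <= Pr_Qdp p (structured (K / 2 ^+ d)).
Proof.
move=> L0 Ld a02 /andP[ap p1] y1 z2; have /andP[a0 a2] := a02.
have d0 : (0 < d)%N.
  by rewrite -(@ltn_exp2l 2) //; lia.
have a1 : 0 < 1 - a by lra.
have a01 : 0 <= a <= 1 by lra.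
pose b := (p - a) / (1 - a).
have bE : 1 - b = (1 - p) / (1 - a) by rewrite /b; field; rewrite gt_eqF.
have b01 : 0 <= b <= 1.
  by rewrite /b ler_pdivlMr // ler_pdivrMr //; lra.
rewrite Pr_Qdp_compl lerD2l lerN2.
apply: le_trans (prob_sprinkle (B := rough L) (b := 2 * z) (edge_prob01 a01) (edge_prob01 b01) _ _ _) _.
- move=> e; rewrite /edge_prob; case: ifP => _; last by ring.
  by rewrite bE; field; rewrite gt_eqF.
- rewrite !mulr_ge0 ?exprn_ge0 // divr_ge0 //; lra.
- move=> F smooth.
  have [FQ|FQ] := boolP (F \subset Qedges d).
    rewrite /z -bE; apply: le_trans (prob_unjoined L0 b01 FQ smooth _); last by rewrite bE.
    apply: prob_sub; first exact: edge_prob01.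
    move=> F' /andP[GQ]; apply: contraNT => joined.
    exact: second_round_structured.
  rewrite /prob big_pred0 => [|F'].
    by rewrite !mulr_ge0 ?exprn_ge0 // divr_ge0 //; lra.
  by rewrite subUset (negbTE FQ).
by rewrite lerD2r prob_rough.
Qed.

End RoundBounds.

(** * Size of the error terms *)

Section Estimates.
Variables (R : realFieldType) (d : nat).
(** All the error terms are compared with powers whose exponent is a multiple of
    [m].  Taking [2 ^ m], about [2^(d/16)], as the size threshold leaves room on
    both sides: it exceeds the expected number [(65/64)^d] of isolated vertices, and
    its fifth power, which enters the union bound over grown sets, is well below
    [2^d]. *)
Let m := (d %/ 16)%N.
Local Notation E := ((3 / 4 : R) ^+ m).
Local Notation two k := ((2 : R) ^+ k).

Lemma div16_bounds : (16 * m <= d <= 16 + 16 * m)%N.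
Proof. by have := divn_eq d 16; have := ltn_pmod d (ltn0Sn 15); rewrite -/m; lia. Qed.

Lemma two_le a b : (a <= b)%N -> two a <= two b.
Proof. by move=> ab; rewrite ler_weXn2l // ler1n. Qed.

Lemma two_gt0 k : 0 < two k.
Proof. by rewrite exprn_gt0. Qed.

Lemma linear_bound : d%:R <= 144 * (9 / 8 : R) ^+ m.
Proof.
have h : (8 / 9 : R) ^+ m * (1 + m%:R / 9) <= 1.
  have := @expr_1D_le R (- (1 / 9)) m.
  have -> : 1 + - (1 / 9) = 8 / 9 :> R by lra.
  have -> : 1 - m%:R * - (1 / 9) = 1 + m%:R / 9 :> R by lra.
  by apply; lra.
have -> : (9 / 8 : R) = (8 / 9)^-1 by rewrite invf_div.
have e0 : 0 < (8 / 9 : R) ^+ m by rewrite exprn_gt0 //; lra.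
rewrite exprVn ler_pdivlMr //.
have H : d%:R <= 144 * (1 + m%:R / 9) :> R.
  have : d%:R <= (16 * m.+1)%:R :> R by rewrite ler_nat; have := div16_bounds; lia.
  by rewrite natrM -natr1; lra.
apply: le_trans (_ : 144 * ((8 / 9) ^+ m * (1 + m%:R / 9)) <= _); last by lra.
by rewrite mulrCA mulrC ler_wpM2l // ltW.
Qed.

(** [65/64] is [2 q] for [q = 65/128], the probability that an edge is missing in
    the first round: this bounds the expected number of isolated vertices. *)
Lemma growth_bound : (65 / 64 : R) ^+ d <= 4 / 3 * (4 / 3) ^+ m.
Proof.
have g16 : (65 / 64 : R) ^+ 16 <= 4 / 3.
  have h : (1 + 1 / 64 : R) ^+ 16 * (1 - 16 * (1 / 64)) <= 1 by apply: expr_1D_le; lra.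
  have -> : (65 / 64 : R) = 1 + 1 / 64 by lra.
  by move: h; set t := _ ^+ 16 => h; lra.
have g1 : 1 <= 65 / 64 :> R by lra.
rewrite -exprS (le_trans (ler_weXn2l g1 (_ : d <= 16 * m.+1)%N)) //.
  by have := div16_bounds; lia.
by rewrite exprM lerXn2r // nnegrE ?exprn_ge0 //; lra.
Qed.

(** Since [(129/130)^130 <= 1/2], the exponent [2^m], which eventually exceeds
    [130 * 17 * m], is enough to beat [2^(17 m)]. *)
Lemma halving_bound (r : R) : (16 <= m)%N -> 0 <= r <= 129 / 130 ->
  r ^+ (2 ^ m) * two (17 * m) <= 1.
Proof.
move=> m16 /andP[r0 r1].
have r130 : (129 / 130 : R) ^+ 130 * 2 <= 1.
  have h : (1 + - (1 / 130) : R) ^+ 130 * (1 - 130 * - (1 / 130)) <= 1 by apply: expr_1D_le; lra.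
  have -> : (129 / 130 : R) = 1 + - (1 / 130) by lra.
  by move: h; set t := _ ^+ 130 => h; lra.
have le_m : (130 * (17 * m) <= 2 ^ m)%N.
  rewrite -(subnK m16); elim: (m - 16)%N => [|k IH]; first by [].
  by rewrite addSn expnS; lia.
have s0 : 0 <= 129 / 130 :> R by lra.
apply: le_trans (_ : (129 / 130) ^+ (130 * (17 * m)) * two (17 * m) <= _).
  rewrite ler_wpM2r ?exprn_ge0 //.
  apply: le_trans (_ : (129 / 130) ^+ (2 ^ m) <= _).
    by rewrite lerXn2r // nnegrE.
  by rewrite ler_wiXn2l //; lra.
by rewrite exprM -exprMn exprn_ile1 // mulr_ge0 ?exprn_ge0.
Qed.

Let K : R := (2 * 2 ^ m)%:R.

Lemma KE : K = two m.+1.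
Proof. by rewrite /K -expnS natrX. Qed.

Lemma delta_bound : K / two d <= 2 / two m.
Proof.
rewrite KE exprS -mulrA ler_wpM2l //.
rewrite ler_pdivrMr ?two_gt0 // mulrC ler_pdivlMr ?two_gt0 // -exprD.
by apply: two_le; have := div16_bounds; lia.
Qed.

Let y : R := K ^+ 2 * d%:R * (65 / 128) ^+ d.

Lemma y_bound : y <= two 10 / two (13 * m).
Proof.
rewrite ler_pdivlMr ?two_gt0 // /y.
have -> : (65 / 128 : R) = 65 / 64 / 2 by lra.
rewrite [(65 / 64 / 2) ^+ d]expr_div_n KE -exprM.
apply: le_trans (_ : two (m.+1 * 2) * (144 * (9 / 8) ^+ m) * (4 / 3 * (4 / 3) ^+ m / two (16 * m)) * two (13 * m) <= _).
  rewrite ler_wpM2r ?exprn_ge0 // ler_pM //.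
  - by rewrite mulr_ge0 ?exprn_ge0.
  - by rewrite divr_ge0 ?exprn_ge0 //; lra.
  - by rewrite ler_wpM2l ?exprn_ge0 // linear_bound.
  - rewrite ler_pM ?invr_ge0 ?exprn_ge0 //; first lra; first exact: growth_bound.
    by rewrite lef_pV2 ?posrE ?two_gt0 // two_le //; have := div16_bounds; lia.
have -> : two (m.+1 * 2) * (144 * (9 / 8) ^+ m) * (4 / 3 * (4 / 3) ^+ m / two (16 * m)) * two (13 * m)
   = 768 * ((9 / 8 * (4 / 3)) ^+ m * (two (m * 2) * two (13 * m) / two (16 * m))).
  rewrite (exprMn m (9 / 8)) mulSn (exprD 2 2).
  have c0 : two (16 * m) != 0 by rewrite gt_eqF ?two_gt0.
  move: c0; set a := two (m * 2); set b := two (13 * m); set c := two (16 * m).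
  set u := (9 / 8) ^+ m; set v := (4 / 3) ^+ m => c0.
  by field.
apply: le_trans (_ : 768 * (two m * (two (m * 2) * two (13 * m) / two (16 * m))) <= _).
  rewrite ler_wpM2l // ler_wpM2r ?divr_ge0 ?mulr_ge0 ?exprn_ge0 //.
  by rewrite lerXn2r // ?nnegrE //; lra.
rewrite [two m * _]mulrA -!exprD (_ : m + (m * 2 + 13 * m) = 16 * m)%N; last lia.
rewrite divff ?gt_eqF ?two_gt0 // mulr1.
by rewrite -natrX ler_nat.
Qed.

Lemma y_ge0 : 0 <= y.
Proof. by rewrite /y !mulr_ge0 ?exprn_ge0 //; lra. Qed.

Lemma small_clusters_bound : K * two d * y ^+ 2 <= two 37 / two m.
Proof.
rewrite ler_pdivlMr ?two_gt0 //.
apply: le_trans (_ : two m.+1 * two (16 + 16 * m) * (two 10 / two (13 * m)) ^+ 2 * two m <= _).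
  rewrite KE (ler_wpM2r (ltW (two_gt0 m))) // ler_pM ?sqr_ge0 //.
  - by rewrite mulr_ge0 ?exprn_ge0.
  - by rewrite ler_wpM2l ?exprn_ge0 // two_le //; have := div16_bounds; lia.
  - by rewrite lerXn2r ?y_bound // nnegrE ?divr_ge0 ?exprn_ge0 //; exact: y_ge0.
have -> : (two 10 / two (13 * m)) ^+ 2 = two 20 / two (13 * m * 2).
  by rewrite expr_div_n -(exprM 2 10) -(exprM 2 (13 * m)).
rewrite -exprD mulrA -exprD mulrAC -exprD ler_pdivrMr ?two_gt0 // -exprD two_le //; lia.
Qed.

Lemma isolated_bound : d%:R * (2 * (65 / 128)) ^+ d / (2 ^ m)%:R <= 192 * E.
Proof.
rewrite ler_pdivrMr ?ltr0n ?expn_gt0 // natrX -mulrA -exprMn.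
have -> : 2 * (65 / 128) = 65 / 64 :> R by lra.
have -> : 192 * (3 / 4 * 2) ^+ m = 144 * (9 / 8) ^+ m * (4 / 3 * (4 / 3) ^+ m) :> R.
  have -> : 3 / 4 * 2 = 9 / 8 * (4 / 3) :> R by lra.
  by rewrite exprMn; lra.
by rewrite ler_pM ?exprn_ge0 ?linear_bound ?growth_bound //; lra.
Qed.

Lemma sprinkle_bound (r : R) : (16 <= m)%N -> 0 <= r <= 129 / 130 ->
  two d * r ^+ (2 ^ m) <= two 16 / two m.
Proof.
move=> m16 r01; have /andP[r0 _] := r01.
rewrite ler_pdivlMr ?two_gt0 //.
apply: le_trans (_ : two 16 * (r ^+ (2 ^ m) * two (17 * m)) <= _); last first.
  by rewrite ler_piMr ?exprn_ge0 // halving_bound.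
rewrite mulrAC [leRHS]mulrCA [leRHS]mulrC -exprD -exprD ler_wpM2r ?exprn_ge0 //.
by apply: two_le; have := div16_bounds; lia.
Qed.

Lemma half_pow_le : (two m)^-1 <= E.
Proof. by rewrite -exprVn lerXn2r ?nnegrE ?invr_ge0 //; lra. Qed.

End Estimates.

(** * Asymptotics *)

From mathcomp Require Import all_classical all_reals all_analysis.
Import numFieldNormedType.Exports.
Local Open Scope classical_set_scope.
Local Open Scope ring_scope.

Lemma cvg_expr_div16 (R : realType) (C z : R) : `|z| < 1 ->
  C * z ^+ (d %/ 16)%N @[d --> \oo] --> (0 : R).
Proof.
move=> z1; rewrite -[X in _ --> X](mulr0 C); apply: cvgMr.
apply: (@cvg_comp _ _ _ (fun d => (d %/ 16)%N) (fun m => z ^+ m) _ \oo); last exact: cvg_expr.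
apply/cvgnyPge => A; near=> d.
rewrite leq_divRL //; near: d; exact: nbhs_infty_ge.
Unshelve. all: by end_near. Qed.

Lemma whp_sub (R : realType) (p : nat -> R) (A B : forall d, pred {set {set Qvertex d}}) :
  (forall d, 0 <= p d <= 1) -> (forall d F, A d F -> B d F) -> whp p A -> whp p B.
Proof.
rewrite /whp => p01 AB whpA; apply: (squeeze_cvgr _ whpA (cvg_cst (1 : R))).
near=> d; have P01 := edge_prob01 (p01 d).
rewrite !Pr_QdpE prob_le1 // andbT prob_sub // => F /andP[-> /AB]; exact.
Unshelve. all: by end_near. Qed.

Theorem proposition2 (R : realType) :
  exists2 eps0 : R, 0 < eps0 &
  forall eps : R, 0 < eps -> eps <= eps0 ->
  forall p : nat -> R,
    (forall d, 0 <= p d <= 1) ->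
    (forall d, 1 / 2 - eps <= p d) ->
  exists2 delta : nat -> R, delta @ \oo --> (0 : R) &
    whp p (fun d F => [exists C, unique_large (delta d) F C]) /\
    whp p (fun d F => [exists C,
      [&& unique_large (delta d) F C, others_isolated F C & isolated_far F]]).
Proof.
exists (1 / 256); first lra.
move=> eps eps_gt0 eps_le p p01 p_ge.
pose m d := (d %/ 16)%N.
pose delta d : R := (2 * 2 ^ m d)%:R / 2 ^+ d.
have E_cvg (C : R) : C * (3 / 4) ^+ m d @[d --> \oo] --> (0 : R).
  by apply: cvg_expr_div16; rewrite ger0_norm; lra.
have mC (C : R) d : 0 <= C -> C / 2 ^+ m d <= C * (3 / 4) ^+ m d.
  by move=> C0; rewrite ler_wpM2l // half_pow_le.
have m_ge : \forall d \near \oo, (20 <= m d)%N.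
  by near=> d; rewrite leq_divRL //; near: d; exact: nbhs_infty_ge.
have main : whp p (fun d => @structured R d (delta d)).
  pose C : R := 2 ^+ 37 + 192 + 2 * 2 ^+ 16.
  have lower : (fun d => 1 - C * (3 / 4) ^+ m d) @ \oo --> (1 : R).
    by rewrite -[X in _ --> X]subr0; apply: cvgB; [exact: cvg_cst | exact: E_cvg].
  rewrite /whp; apply: (squeeze_cvgr _ lower (cvg_cst (1 : R))).
  near=> d.
  have m20 : (20 <= m d)%N by near: d; exact: m_ge.
  have m16 : (16 <= m d)%N by exact: leq_trans m20.
  have qE : 1 - 63 / 128 = 65 / 128 :> R by lra.
  have /andP[p0 p1] := p01 d; have pge := p_ge d.
  pose r := (1 - p d) / (1 - 63 / 128).
  (* [129 / 130] is [(1/2 + 1/256) / (65/128)]. *)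
  have r01 : 0 <= r <= 129 / 130.
    by rewrite /r qE divr_ge0 ?ler_pdivrMr; lra.
  apply/andP; split; last by rewrite Pr_QdpE prob_le1 //; exact: edge_prob01.
  have L0 : (0 < 2 ^ m d)%N by rewrite expn_gt0.
  have Ld : (2 * 2 ^ m d + 1 < 2 ^ d)%N.
    rewrite -expnS; apply: (@leq_trans (2 ^ (m d).+2)).
      have t2 : (2 ^ 1 <= 2 ^ (m d).+1)%N by rewrite leq_exp2l.
      by rewrite [leqRHS]expnS mul2n -addnn -addnS leq_add2l.
    by rewrite leq_exp2l //; have := div16_bounds d; rewrite -/(m d); lia.
  have y1 := y_bound R d.
  have z1 := sprinkle_bound m16 r01.
  have two_small (j k : nat) : (j <= k)%N -> 2 ^+ j / 2 ^+ k <= (1 : R).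
    by move=> jk; rewrite ler_pdivrMr ?two_gt0 // mul1r two_le.
  (* First round with edge probability [63/128 = 1/2 - 2/256]. *)
  apply: le_trans (@Pr_structured R d (63 / 128) (p d) (2 ^ m d) L0 Ld _ _ _ _).
  - have CE (a b c e : R) : (a + b + 2 * c) * e = a * e + b * e + 2 * (c * e) by ring.
    rewrite /r qE in z1; rewrite qE lerD2l lerN2 /C CE.
    apply: lerD; last first.
      rewrite ler_wpM2l //.
      by apply: le_trans z1 _; apply: mC; rewrite exprn_ge0.
    apply: lerD; last exact: isolated_bound.
    apply: le_trans (mC _ _ _); last by rewrite exprn_ge0.
    exact: small_clusters_bound.
  - by lra.
  - by lra.
  - by rewrite qE; apply: le_trans y1 _; rewrite -/(m d); apply: two_small; lia.
  - apply: le_trans z1 _.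
    by rewrite ler_pdivlMr // mulrAC -exprSr two_small // (leq_trans _ m20).
exists delta.
  apply: (squeeze_cvgr _ (cvg_cst (0 : R)) (E_cvg 2)); near=> d.
  rewrite divr_ge0 ?exprn_ge0 //=; apply: le_trans (delta_bound R d) _.
  exact: mC.
split; last exact: main.
apply: (whp_sub p01 _ main) => d F /existsP[C /andP[big _]].
by apply/existsP; exists C.
Unshelve. all: by end_near. Qed.
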